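(* Let $I\subset\mathbb{R}$ be an interval with interior $I^{\circ}$, let $f:I\to\mathbb{R}$ be twice differentiable on $I^{\circ}$, and let $a,b\in I^{\circ}$ with $a<b$. Suppose that $|f''|$ is $P$-convex on $[a,b]$ and let $0\le\lambda\le 1$. Then $$\left|(\lambda-1)f\left(\frac{a+b}{2}\right)-\lambda\frac{f(a)+f(b)}{2}+\frac{1}{b-a}\int_a^b f(x)\,dx\right|\le\begin{cases}\dfrac{(b-a)^2}{24}\,(8\lambda^3-3\lambda+1)\,\bigl(|f''(a)|+|f''(b)|\bigr), & 0\le\lambda\le\frac12,\\[2mm] \dfrac{(b-a)^2}{24}\,(3\lambda-1)\,\bigl(|f''(a)|+|f''(b)|\bigr), & \frac12\le\lambda\le 1.\end{cases}$$
   Context: A function $g:J\to\mathbb{R}$ on an interval $J\subseteq\mathbb{R}$ is called $P$-convex (or a $P$-function) if it is nonnegative and $g(\mu x+(1-\mu)y)\le g(x)+g(y)$ for all $x,y\in J$ and all $\mu\in[0,1]$. *)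

(* Defs.v *)
From Stdlib Require Import Reals.
From Coquelicot Require Import Coquelicot.
Open Scope R_scope.

(** Order-convexity: this covers open, closed, half-open and unbounded
    intervals. *)
Definition is_interval (I : R -> Prop) : Prop :=
  forall x y z : R, I x -> I y -> x <= z <= y -> I z.

(** [J] is meant to be an interval; [g] is a total function whose values
    outside [J] are irrelevant when [J] is one. *)
Definition P_convex_on (J : R -> Prop) (g : R -> R) : Prop :=
  (forall x : R, J x -> 0 <= g x) /\
  (forall x y mu : R, J x -> J y -> 0 <= mu <= 1 ->
     g (mu * x + (1 - mu) * y) <= g x + g y).

(** [ex_derive_n f 2 x] only says that the total function [Derive f] is
    differentiable at [x], so differentiability of [f] is required separately. *)
Definition twice_differentiable_on (D : R -> Prop) (f : R -> R) : Prop :=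
  forall x : R, D x -> ex_derive f x /\ ex_derive_n f 2 x.

(* Main.v *)
(** Write [h = b - a], [m] for the midpoint, and let [k] be the Peano kernel of
    the quadrature rule: [(x - a) (x - a - lambda h) / 2] on [[a, m]] and
    [(x - b) (x - b + lambda h) / 2] on [[m, b]].  Integrating [k f''] by parts
    twice gives [h] times the quantity to be estimated, and [P]-convexity gives
    [|f''| <= |f''(a)| + |f''(b)|], so the bound is the integral of [|k|].  As
    [f''] need not be integrable, the integral of [k f''] is replaced by the
    increments of the antiderivative [k f' - k' f + F], [F' = f], which are
    compared with those of a primitive of [|k|] by the mean value theorem. *)
Require Import Defs.
From Stdlib Require Import Reals Lra.
From Coquelicot Require Import Coquelicot.
Open Scope R_scope.

Lemma incr_le_of_derive_le (g w dg dw : R -> R) (p q : R) :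
  p <= q ->
  (forall x, p <= x <= q -> is_derive g x (dg x)) ->
  (forall x, p <= x <= q -> is_derive w x (dw x)) ->
  (forall x, p <= x <= q -> dg x <= dw x) ->
  g q - g p <= w q - w p.
Proof.
intros Hpq Hg Hw Hle.
assert (Hd : forall x, p <= x <= q ->
    is_derive (fun y => w y - g y) x (dw x - dg x)).
{ intros x Hx; apply (is_derive_minus w g); auto. }
destruct (MVT_gen (fun y => w y - g y) p q (fun x => dw x - dg x)) as [c [Hc Heq]].
- intros x; rewrite Rmin_left, Rmax_right by lra; intros Hx; apply Hd; lra.
- intros x; rewrite Rmin_left, Rmax_right by lra; intros Hx.
  apply derivable_continuous_pt; exists (dw x - dg x).
  apply is_derive_Reals, Hd; lra.
- rewrite Rmin_left, Rmax_right in Hc by lra.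
  assert (0 <= (dw c - dg c) * (q - p)).
  { apply Rmult_le_pos; [specialize (Hle c Hc)|]; lra. }
  lra.
Qed.

Lemma Rabs_incr_le_of_derive_le (g w dg dw : R -> R) (p q : R) :
  p <= q ->
  (forall x, p <= x <= q -> is_derive g x (dg x)) ->
  (forall x, p <= x <= q -> is_derive w x (dw x)) ->
  (forall x, p <= x <= q -> Rabs (dg x) <= dw x) ->
  Rabs (g q - g p) <= w q - w p.
Proof.
intros Hpq Hg Hw Hle; apply Rabs_le; split.
- assert (- g q - - g p <= w q - w p); [|lra].
  apply (incr_le_of_derive_le (fun x => - g x) w (fun x => - dg x) dw); auto.
  + intros x Hx; apply (is_derive_opp g); auto.
  + intros x Hx; specialize (Hle x Hx); apply Rabs_le_between in Hle; lra.
- apply (incr_le_of_derive_le g w dg dw); auto.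
  intros x Hx; specialize (Hle x Hx); apply Rabs_le_between in Hle; lra.
Qed.

(** One branch of the Peano kernel, given by its roots: [r] is an endpoint of the integration
    interval, and [s] lies at distance [lambda * h] from it, towards the other endpoint. *)
Definition kernel (r s x : R) : R := (x - r) * (x - s) / 2.

Definition kernel_prim (r s x : R) : R :=
  x ^ 3 / 6 - (r + s) * x ^ 2 / 4 + r * s * x / 2.

(** The factor [x - (r + s) / 2] is the derivative of [kernel r s], whose second derivative is 1.
    Hence, on differentiating, all terms cancel except [kernel r s x * f2 x]. *)
Definition by_parts (F f f1 : R -> R) (r s x : R) : R :=
  kernel r s x * f1 x - (x - (r + s) / 2) * f x + F x.

Lemma is_derive_kernel_prim (r s x : R) :
  is_derive (kernel_prim r s) x (kernel r s x).
Proof. unfold kernel_prim, kernel; auto_derive; [easy|field]. Qed.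

Lemma is_derive_by_parts (F f f1 f2 : R -> R) (r s x : R) :
  is_derive F x (f x) -> is_derive f x (f1 x) -> is_derive f1 x (f2 x) ->
  is_derive (by_parts F f f1 r s) x (kernel r s x * f2 x).
Proof.
intros HF Hf Hf1; unfold by_parts, kernel; auto_derive.
- repeat split; eexists; eassumption.
- change (fun x0 : R => F x0) with F; change (fun x0 : R => f x0) with f;
  change (fun x0 : R => f1 x0) with f1.
  rewrite (is_derive_unique _ _ _ HF), (is_derive_unique _ _ _ Hf),
    (is_derive_unique _ _ _ Hf1); field.
Qed.

(** The number [sg] records a constant sign of the kernel on the segment, so that
    [sg * kernel_prim r s] is a polynomial primitive of its absolute value there. *)
Lemma by_parts_incr_le (F f f1 f2 : R -> R) (r s p q M sg : R) :
  p <= q ->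
  (forall x, p <= x <= q -> is_derive F x (f x)) ->
  (forall x, p <= x <= q -> is_derive f x (f1 x)) ->
  (forall x, p <= x <= q -> is_derive f1 x (f2 x)) ->
  (forall x, p <= x <= q -> Rabs (f2 x) <= M) ->
  (forall x, p <= x <= q -> Rabs (kernel r s x) = sg * kernel r s x) ->
  Rabs (by_parts F f f1 r s q - by_parts F f f1 r s p) <=
  M * sg * (kernel_prim r s q - kernel_prim r s p).
Proof.
intros Hpq HF Hf Hf1 HM Hsg; rewrite Rmult_minus_distr_l.
apply (Rabs_incr_le_of_derive_le (by_parts F f f1 r s)
  (fun x => M * sg * kernel_prim r s x)
  (fun x => kernel r s x * f2 x) (fun x => M * sg * kernel r s x)); auto.
- intros x Hx; apply is_derive_by_parts; auto.
- intros x _; apply (is_derive_scal (kernel_prim r s)), is_derive_kernel_prim.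
- intros x Hx; rewrite Rabs_mult, Rmult_assoc, <- Hsg, Rmult_comm by easy.
  apply Rmult_le_compat_r; [apply Rabs_pos | auto].
Qed.

Lemma Rabs_kernel_pos (r s x : R) :
  0 <= (x - r) * (x - s) -> Rabs (kernel r s x) = 1 * kernel r s x.
Proof. intros H; unfold kernel; rewrite Rabs_pos_eq; lra. Qed.

Lemma Rabs_kernel_neg (r s x : R) :
  (x - r) * (x - s) <= 0 -> Rabs (kernel r s x) = -1 * kernel r s x.
Proof. intros H; unfold kernel; rewrite Rabs_left1; lra. Qed.

(** A point [t] near [z] lies between the translates of [x] and [y] by [t - z], and both translates
    remain in [I] when the shift is small. *)
Lemma is_interval_interior (I : R -> Prop) :
  is_interval I -> is_interval (interior I).
Proof.
intros HI x y z [dx Hx] [dy Hy] Hz.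
assert (Hd : 0 < Rmin dx dy) by (apply Rmin_pos; apply cond_pos).
exists (mkposreal _ Hd); intros t Ht; change (Rabs (t - z) < Rmin dx dy) in Ht.
assert (Hdx := Rmin_l dx dy); assert (Hdy := Rmin_r dx dy).
apply (HI (x + (t - z)) (y + (t - z))).
- apply Hx; change (Rabs (x + (t - z) - x) < dx).
  replace (x + (t - z) - x) with (t - z) by ring; lra.
- apply Hy; change (Rabs (y + (t - z) - y) < dy).
  replace (y + (t - z) - y) with (t - z) by ring; lra.
- lra.
Qed.

(** The derivative is two-sided even at [x = a], so integrability is needed for all [y] near [x], on
    either side of [a]. It holds because the segment joining [a] to such a [y] stays in the
    interior, where [f] is continuous. *)
Lemma is_derive_RInt_interior (I : R -> Prop) (f : R -> R) (a x : R) :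
  is_interval I -> (forall y, interior I y -> continuous f y) ->
  interior I a -> interior I x -> is_derive (RInt f a) x (f x).
Proof.
intros HI Hf Ha Hx; apply (is_derive_RInt f _ a); [|auto].
(* Stdlib's [interior] is convertible to Coquelicot's [locally]. *)
apply filter_imp with (2 := locally_locally x I Hx); intros y Hy.
apply (RInt_correct f), ex_RInt_continuous; intros z Hz; apply Hf.
assert (HJ := is_interval_interior I HI).
destruct (Rle_dec a y).
- rewrite Rmin_left, Rmax_right in Hz by lra; now apply (HJ a y).
- rewrite Rmin_right, Rmax_left in Hz by lra; now apply (HJ y a).
Qed.

Lemma P_convex_on_le (a b : R) (g : R -> R) (x : R) :
  a < b -> P_convex_on (fun t => a <= t <= b) g -> a <= x <= b ->
  g x <= g a + g b.
Proof.
intros Hab [_ HP] Hx.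
replace x with ((b - x) / (b - a) * a + (1 - (b - x) / (b - a)) * b)
  by (field; lra).
apply HP; try lra; split.
- apply Rdiv_le_0_compat; lra.
- apply Rle_div_l; lra.
Qed.

Theorem theorem4 (I : R -> Prop) (f : R -> R) (a b lambda : R)
  (HI : is_interval I)
  (Hf : twice_differentiable_on (interior I) f)
  (Ha : interior I a) (Hb : interior I b) (Hab : a < b)
  (HP : P_convex_on (fun x => a <= x <= b) (fun x => Rabs (Derive_n f 2 x)))
  (Hlambda : 0 <= lambda <= 1) :
  let E := Rabs ((lambda - 1) * f ((a + b) / 2)
                 - lambda * ((f a + f b) / 2)
                 + 1 / (b - a) * RInt f a b) in
  let S := Rabs (Derive_n f 2 a) + Rabs (Derive_n f 2 b) in
  (0 <= lambda <= 1 / 2 ->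
     E <= (b - a) ^ 2 / 24 * (8 * lambda ^ 3 - 3 * lambda + 1) * S) /\
  (1 / 2 <= lambda <= 1 ->
     E <= (b - a) ^ 2 / 24 * (3 * lambda - 1) * S).
Proof.
intros E S.
assert (HJ : forall x, a <= x <= b -> interior I x).
{ intros x Hx; now apply (is_interval_interior I HI a b). }
assert (HF : forall x, a <= x <= b -> is_derive (RInt f a) x (f x)).
{ intros x Hx; apply (is_derive_RInt_interior I); auto.
  intros y Hy; apply (ex_derive_continuous f), (Hf y Hy). }
assert (Hf1 : forall x, a <= x <= b -> is_derive f x (Derive f x)).
{ intros x Hx; apply Derive_correct, (Hf x (HJ x Hx)). }
assert (Hf2 : forall x, a <= x <= b ->
    is_derive (Derive f) x (Derive_n f 2 x)).
{ intros x Hx; apply (Derive_correct (Derive f)), (Hf x (HJ x Hx)). }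
assert (HS : forall x, a <= x <= b -> Rabs (Derive_n f 2 x) <= S).
{ intros x Hx; now apply (P_convex_on_le a b (fun t => Rabs (Derive_n f 2 t))). }
assert (Hpiece : forall r s p q sg, a <= p -> p <= q -> q <= b ->
    (forall x, p <= x <= q -> Rabs (kernel r s x) = sg * kernel r s x) ->
    Rabs (by_parts (RInt f a) f (Derive f) r s q -
          by_parts (RInt f a) f (Derive f) r s p) <=
    S * sg * (kernel_prim r s q - kernel_prim r s p)).
{ intros r s p q sg Hp Hpq Hq Hsg.
  apply (by_parts_incr_le _ _ _ (Derive_n f 2)); trivial; intros x Hx;
    [apply HF|apply Hf1|apply Hf2|apply HS]; lra. }
set (h := b - a); set (m := (a + b) / 2).
set (L := by_parts (RInt f a) f (Derive f) a (a + lambda * h)).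
set (R' := by_parts (RInt f a) f (Derive f) b (b - lambda * h)).
assert (Hh : 0 < h) by (unfold h; lra).
(* The terms in [f'] disappear: the branches vanish at [a] and [b] respectively and agree at [m].
   The slope of the kernel jumps at [m], which yields the coefficient [(lambda - 1) * h] of
   [f m]. *)
assert (HE : E = Rabs ((L m - L a) + (R' b - R' m)) / h).
{ unfold E; rewrite <- (Rabs_pos_eq h) by lra.
  rewrite <- Rabs_div by lra; f_equal.
  unfold L, R', by_parts, kernel; fold m.
  rewrite (RInt_point a f : RInt f a a = 0).
  generalize (f m) (Derive f m); intros fm f1m; unfold m, h; field; lra. }
assert (Hfin : forall B, Rabs (L m - L a) + Rabs (R' b - R' m) <= B * h -> E <= B).
{ intros B HB; rewrite HE; apply Rle_div_l; [lra|].
  apply Rle_trans with (2 := HB), Rabs_triang. }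
split; intros Hl; apply Hfin.
(* Here the roots [a + c] and [b - c] fall inside their halves, so each half is cut there: the
   kernel is nonpositive on the outer pieces and nonnegative on the inner ones. *)
- assert (Hc : 0 <= lambda * h <= h / 2) by nra.
  assert (Hab' : b = a + h /\ m = a + h / 2) by (unfold m, h; lra).
  destruct Hab' as [Hbh Hmh].
  set (c := lambda * h) in *.
  assert (H1 : Rabs (L (a + c) - L a) <=
      S * -1 * (kernel_prim a (a + c) (a + c) - kernel_prim a (a + c) a)).
  { apply Hpiece; try lra; intros x Hx; apply Rabs_kernel_neg; nra. }
  assert (H2 : Rabs (L m - L (a + c)) <=
      S * 1 * (kernel_prim a (a + c) m - kernel_prim a (a + c) (a + c))).
  { apply Hpiece; try lra; intros x Hx; apply Rabs_kernel_pos; nra. }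
  assert (H3 : Rabs (R' (b - c) - R' m) <=
      S * 1 * (kernel_prim b (b - c) (b - c) - kernel_prim b (b - c) m)).
  { apply Hpiece; try lra; intros x Hx; apply Rabs_kernel_pos; nra. }
  assert (H4 : Rabs (R' b - R' (b - c)) <=
      S * -1 * (kernel_prim b (b - c) b - kernel_prim b (b - c) (b - c))).
  { apply Hpiece; try lra; intros x Hx; apply Rabs_kernel_neg; nra. }
  assert (HL := Rabs_triang (L m - L (a + c)) (L (a + c) - L a)).
  assert (HR := Rabs_triang (R' b - R' (b - c)) (R' (b - c) - R' m)).
  replace (L m - L (a + c) + (L (a + c) - L a)) with (L m - L a) in HL by ring.
  replace (R' b - R' (b - c) + (R' (b - c) - R' m)) with (R' b - R' m) in HR
    by ring.
  apply Rle_trans with (1 := Rplus_le_compat _ _ _ _ HL HR).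
  apply Rle_trans with
    (1 := Rplus_le_compat _ _ _ _ (Rplus_le_compat _ _ _ _ H2 H1)
                                  (Rplus_le_compat _ _ _ _ H4 H3)).
  (* By symmetry each half contributes [S * (c ^ 3 / 6 - c * h ^ 2 / 16 + h ^ 3 / 48)]; the cubic
     term in [lambda] comes from the change of sign. *)
  right; unfold kernel_prim; rewrite Hmh, Hbh; unfold c; field.
(* Now neither root is interior to its half, so the kernel is nonpositive on all of [[a, b]]. Each
   half contributes [S * (c * h ^ 2 / 16 - h ^ 3 / 48)], which is linear in [lambda]. *)
- assert (Hc : h / 2 <= lambda * h <= h) by nra.
  assert (Hab' : b = a + h /\ m = a + h / 2) by (unfold m, h; lra).
  destruct Hab' as [Hbh Hmh].
  set (c := lambda * h) in *.
  assert (H1 : Rabs (L m - L a) <=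
      S * -1 * (kernel_prim a (a + c) m - kernel_prim a (a + c) a)).
  { apply Hpiece; try lra; intros x Hx; apply Rabs_kernel_neg; nra. }
  assert (H2 : Rabs (R' b - R' m) <=
      S * -1 * (kernel_prim b (b - c) b - kernel_prim b (b - c) m)).
  { apply Hpiece; try lra; intros x Hx; apply Rabs_kernel_neg; nra. }
  apply Rle_trans with (1 := Rplus_le_compat _ _ _ _ H1 H2).
  right; unfold kernel_prim; rewrite Hmh, Hbh; unfold c; field.
Qed.
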